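(* Every topological space with a $\Sigma_2$-base admits an $\omega^\omega$-base. That is, if $X$ is a topological space that has a $\Sigma$-base for some boundedly complete sub-poset $\Sigma$ of $\omega^\omega$, then $X$ has an $\omega^\omega$-base.
   Context: All topological spaces are assumed to be Tychonoff. $\omega^\omega$ is the set of all functions $\omega\to\omega$ with the pointwise order. A subset of a poset is bounded if it has an upper bound in that poset. A subset $\Sigma\subseteq\omega^\omega$, with the induced order, is boundedly complete if every subset of $\Sigma$ that is bounded in $\omega^\omega$ has an upper bound belonging to $\Sigma$. A subset $C$ of a poset $P$ is cofinal if for every $p\in P$ there is $q\in C$ with $p\leq q$. For directed sets $P,Q$, $Q$ is a Tukey quotient of $P$ if there is a map $\phi:P\to Q$ carrying cofinal subsets of $P$ to cofinal subsets of $Q$. For a directed set $P$, a space $X$ has a neighborhood $P$-base at $x\in X$ if the poset of neighborhoods of $x$, ordered by reverse inclusion, is a Tukey quotient of $P$ (equivalently, there is a neighborhood base $\{U_p:p\in P\}$ at $x$ with $U_q\subseteq U_p$ whenever $p\leq q$). $X$ has a $P$-base if it has a neighborhood $P$-base at each of its points. A $\Sigma$-base is called a $\Sigma_2$-base if $\Sigma$ is a boundedly complete sub-poset of $\omega^\omega$. *)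

(* Defs.v *)
From HB Require Import structures.
From mathcomp Require Import all_boot all_order.
From mathcomp Require Import all_classical all_reals all_analysis.

Set Implicit Arguments.
Unset Strict Implicit.
Unset Printing Implicit Defensive.

Import Order.TTheory.
Local Open Scope classical_set_scope.

(* A subset of a poset as a type, with the induced order (an alias of
   [set_type], which has no order of its own). *)
Definition subposet (d : Order.disp_t) (T : porderType d) (A : set T) : Type :=
  set_type A.
HB.instance Definition _ (d : Order.disp_t) (T : porderType d) (A : set T) :=
  SubChoice.on (subposet A).
HB.instance Definition _ (d : Order.disp_t) (T : porderType d) (A : set T) :=
  [SubChoice_isSubPOrder of subposet A by <: with d].

Definition cofinal (d : Order.disp_t) (P : porderType d) (C : set P) : Prop :=
  forall p : P, exists2 q : P, C q & (p <= q)%O.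

Definition directed (d : Order.disp_t) (P : porderType d) : Prop :=
  [set: P] !=set0 /\
  forall p q : P, exists2 r : P, (p <= r)%O & (q <= r)%O.

(* [Q] is a Tukey quotient of [P]. This is meant for directed [P] and [Q];
   the lemmas [directed_*] at the end of this file show that the posets of
   interest are directed. *)
Definition tukey_quotient (d d' : Order.disp_t)
    (P : porderType d) (Q : porderType d') : Prop :=
  exists phi : P -> Q, forall C : set P, cofinal C -> cofinal (phi @` C).

(* [^d] is the dual of the inclusion order on [set X]: in [nbhs_poset x],
   [U <= V] means that [V] is included in [U] (lemma [le_nbhs_poset]).
   Neighborhoods need not be open. *)
Notation nbhs_poset x := (subposet (nbhs x : set ((set _)^d))).

Definition has_nbhs_base (d : Order.disp_t) (P : porderType d)
    (X : topologicalType) (x : X) : Prop :=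
  tukey_quotient P (nbhs_poset x).

Definition has_base (d : Order.disp_t) (P : porderType d)
    (X : topologicalType) : Prop :=
  forall x : X, has_nbhs_base P x.

(* [nat -> nat] carries the pointwise order (lemma [le_omega_omega]), and
   [has_ubound A] is boundedness in [nat -> nat]. *)
Definition boundedly_complete (Sigma : set (nat -> nat)) : Prop :=
  forall A : set (nat -> nat), A `<=` Sigma -> has_ubound A ->
    exists2 s : nat -> nat, Sigma s & ubound A s.

Definition tychonoff_space (X : topologicalType) : Prop :=
  completely_regular_space X /\ hausdorff_space X.

Lemma le_omega_omega (f g : nat -> nat) :
  (f <= g)%O <-> forall n, (f n <= g n)%N.
Proof. by split=> [/asboolP fg n|fg]; [exact: fg|apply/asboolP => n; exact: fg]. Qed.

Lemma le_subposet (d : Order.disp_t) (T : porderType d) (A : set T)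
    (p q : subposet A) :
  (p <= q)%O = (val p <= val q)%O.
Proof. by []. Qed.

Lemma le_nbhs_poset (X : topologicalType) (x : X) (U V : nbhs_poset x) :
  (U <= V)%O <-> (val V : set X) `<=` (val U : set X).
Proof. by split=> [/asboolP|h]; [|apply/asboolP]. Qed.

Lemma directed_omega_omega : directed (nat -> nat).
Proof.
split; first by exists (fun=> 0%N).
move=> f g; exists (fun n => maxn (f n) (g n)); apply/le_omega_omega => n.
  exact: leq_maxl.
exact: leq_maxr.
Qed.

Lemma directed_boundedly_complete (Sigma : set (nat -> nat)) :
  boundedly_complete Sigma -> directed (subposet Sigma).
Proof.
move=> bc; split.
  have [//||s Ss _] := bc set0; first by exists (fun=> 0%N).
  by exists (exist _ s (mem_set Ss)).
move=> p q; have [h ph qh] := directed_omega_omega.2 (val p) (val q).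
have [||s Ss ub] := bc [set f | f = val p \/ f = val q].
- by move=> f [->|->]; exact: set_valP.
- by exists h => f [->|->].
exists (exist _ s (mem_set Ss)); rewrite le_subposet; apply: ub.
  by left.
by right.
Qed.

Lemma directed_nbhs_poset (X : topologicalType) (x : X) :
  directed (nbhs_poset x).
Proof.
split; first by exists (exist _ setT (mem_set (filterT : nbhs x setT))).
move=> U V.
have nUV : nbhs x ((val U : set X) `&` (val V : set X)).
  by apply: filterI; [exact: (set_valP U)|exact: (set_valP V)].
by exists (exist (fun W : set X => W \in nbhs x) _ (mem_set nUV)); apply/le_nbhs_poset => y [].
Qed.

(* Main.v *)
Require Import Defs.
From mathcomp Require Import all_boot all_order.
From mathcomp Require Import all_classical all_reals all_analysis.

Local Open Scope classical_set_scope.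

Lemma tukey_quotient_trans (d1 d2 d3 : Order.disp_t) (P : porderType d1)
    (Q : porderType d2) (R : porderType d3) :
  tukey_quotient P Q -> tukey_quotient Q R -> tukey_quotient P R.
Proof.
move=> [phi phiP] [psi psiP]; exists (psi \o phi) => C cofC.
by rewrite -image_comp; apply/psiP/phiP.
Qed.

(* Send [f] to an upper bound in [Sigma] of the elements of [Sigma] below [f].
   This map need not be monotone, but the image of any [f] above [s] is again
   above [s], so cofinal sets have cofinal images. *)
Lemma boundedly_complete_tukey_quotient (Sigma : set (nat -> nat)) :
  boundedly_complete Sigma -> tukey_quotient (nat -> nat) (subposet Sigma).
Proof.
move=> bc.
have /choice[phi phiP] (f : nat -> nat) : exists t : subposet Sigma,
    forall s : subposet Sigma, (val s <= f)%O -> (s <= t)%O.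
  (* This set is bounded by [f] itself. It may be empty; bounded completeness still yields a point
     of [Sigma], so [phi] is total. *)
  have [||t St ubt] := bc [set s | Sigma s /\ (s <= f)%O].
  - by move=> s [].
  - by exists f => s [].
  exists (exist _ t (mem_set St)) => s sf; rewrite le_subposet.
  by apply: ubt; split=> //; exact: set_valP.
(* Cofinality of [C] is used in all of [nat -> nat]: [f] need not lie in [Sigma], but [phi f]
   does. *)
exists phi => C cofC s; have [f Cf sf] := cofC (val s).
by exists (phi f); [exists f | exact: phiP].
Qed.

Theorem corollary3p4 (X : topologicalType) (hX : tychonoff_space X)
    (Sigma : set (nat -> nat)) (hSigma : boundedly_complete Sigma)
    (hbase : has_base (subposet Sigma) X) :
  has_base (nat -> nat) X.
Proof.
(* At each point, the neighborhood poset is reached from [nat -> nat] through [subposet Sigma]. *)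
move=> x; apply: tukey_quotient_trans (hbase x).
exact: boundedly_complete_tukey_quotient.
Qed.
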